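(* Let $\mathcal V$ be a discriminator variety and let $\mathbf F$ be the free algebra for $\mathcal V$ of denumerable rank. Then $\mathcal V$ is structurally complete if and only if there exists an elementary extension of $\mathbf F$ with an idempotent element or $\mathcal V$ is minimal (as a variety, equivalently as a quasivariety).
   Context: The discriminator operation on a set $A$ is $t(a,b,c)=a$ if $a\neq b$ and $t(a,b,c)=c$ if $a=b$. A variety $\mathcal V$ is a discriminator variety if it is generated by a class $\mathcal K$ of algebras for which there is a single term whose interpretation in every member of $\mathcal K$ is the discriminator operation. $\mathbf F$ is the free algebra for $\mathcal V$ over a countably infinite set of variables. A quasi-identity $(\forall\bar x)[s_1\approx t_1\wedge\dots\wedge s_n\approx t_n\to s\approx t]$ is admissible if it holds in $\mathbf F$; $\mathcal V$ is structurally complete if every admissible quasi-identity holds in all of $\mathcal V$. An element $e$ is idempotent if $f(e,\dots,e)=e$ for every basic operation $f$. A variety (quasivariety) is minimal if its only proper subvariety (subquasivariety) is the trivial one. *)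

(* Defs.v *)
From mathcomp Require Import all_boot.
Set Implicit Arguments.
Unset Strict Implicit.
Unset Printing Implicit Defensive.

(* Finitary algebraic signatures; any set of operation symbols is allowed, and
   constants are symbols of arity 0. *)
Record signature := Signature {
  op : Type;
  arity : op -> nat
}.

(* Algebras are nonempty, as usual in universal algebra. *)
Record algebra (S : signature) := Algebra {
  carrier :> Type;
  interp : forall f : op S, ('I_(arity f) -> carrier) -> carrier;
  carrier_inhabited : inhabited carrier
}.

Definition is_hom (S : signature) (A B : algebra S) (h : A -> B) : Prop :=
  forall (f : op S) (a : 'I_(arity f) -> A),
    h (interp a) = interp (fun i => h (a i)).

Definition idempotent_element (S : signature) (A : algebra S) (e : A) : Prop :=
  forall f : op S, interp (fun _ : 'I_(arity f) => e) = e.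

Definition trivial_algebra (S : signature) (A : algebra S) : Prop :=
  forall a b : A, a = b.

Inductive term (S : signature) (X : Type) : Type :=
| Var (x : X)
| App (f : op S) (args : 'I_(arity f) -> term S X).

Fixpoint eval (S : signature) (X : Type) (A : algebra S) (e : X -> A)
    (t : term S X) : A :=
  match t with
  | Var x => e x
  | App f args => interp (fun i => eval e (args i))
  end.

Record identity (S : signature) := Identity {
  lhs : term S nat;
  rhs : term S nat
}.

Definition sat_identity (S : signature) (A : algebra S) (e : nat -> A)
    (p : identity S) : Prop :=
  eval e (lhs p) = eval e (rhs p).

Definition holds_identity (S : signature) (A : algebra S) (p : identity S) :
    Prop :=
  forall e : nat -> A, sat_identity e p.

Record quasi_identity (S : signature) := QuasiIdentity {
  premise_count : nat;
  premise : 'I_premise_count -> identity S;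
  conclusion : identity S
}.

Definition holds_quasi_identity (S : signature) (A : algebra S)
    (q : quasi_identity S) : Prop :=
  forall e : nat -> A,
    (forall i : 'I_(premise_count q), sat_identity e (premise i)) ->
    sat_identity e (conclusion q).

Definition algebra_class (S : signature) := algebra S -> Prop.

Definition subclass (S : signature) (W V : algebra_class S) : Prop :=
  forall A : algebra S, W A -> V A.

Definition proper_subclass (S : signature) (W V : algebra_class S) : Prop :=
  subclass W V /\ ~ subclass V W.

Definition is_trivial_class (S : signature) (W : algebra_class S) : Prop :=
  forall A : algebra S, W A <-> trivial_algebra A.

Definition is_variety (S : signature) (V : algebra_class S) : Prop :=
  exists E : identity S -> Prop,
    forall A : algebra S, V A <-> (forall p, E p -> holds_identity A p).

Definition is_quasivariety (S : signature) (V : algebra_class S) : Prop :=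
  exists E : quasi_identity S -> Prop,
    forall A : algebra S, V A <-> (forall q, E q -> holds_quasi_identity A q).

(* The trivial variety itself is not minimal: it has no proper subvariety. *)
Definition minimal_variety (S : signature) (V : algebra_class S) : Prop :=
  is_variety V /\
  forall W : algebra_class S, is_variety W ->
    (proper_subclass W V <-> is_trivial_class W).

Definition minimal_quasivariety (S : signature) (V : algebra_class S) : Prop :=
  is_quasivariety V /\
  forall W : algebra_class S, is_quasivariety W ->
    (proper_subclass W V <-> is_trivial_class W).

Definition variety_generated_by (S : signature) (K V : algebra_class S) :
    Prop :=
  [/\ is_variety V, subclass K V
    & forall W : algebra_class S, is_variety W -> subclass K W -> subclass V W].

Definition is_discriminator (A : Type) (t : A -> A -> A -> A) : Prop :=
  forall a b c : A, (a <> b -> t a b c = a) /\ (a = b -> t a b c = c).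

Definition ternary_op (S : signature) (A : algebra S) (t : term S 'I_3)
    (a b c : A) : A :=
  eval (tnth [tuple a; b; c]) t.

Definition discriminator_variety (S : signature) (V : algebra_class S) : Prop :=
  exists K : algebra_class S,
    variety_generated_by K V /\
    exists t : term S 'I_3,
      forall A : algebra S, K A -> is_discriminator (@ternary_op S A t).

(* F is free for V over the variables x 0, x 1, ...; the map x is injective
   unless V is trivial.  This determines F up to isomorphism. *)
Definition is_free_denumerable (S : signature) (V : algebra_class S)
    (F : algebra S) (x : nat -> F) : Prop :=
  V F /\
  forall A : algebra S, V A -> forall v : nat -> A,
    exists h : F -> A,
      [/\ is_hom h, forall n, h (x n) = v n
        & forall g : F -> A, is_hom g -> (forall n, g (x n) = v n) -> g =1 h].

(* Here and below F stands for the free algebra of V of denumerable rank. *)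
Definition admissible (S : signature) (F : algebra S) (q : quasi_identity S) :
    Prop :=
  holds_quasi_identity F q.

Definition structurally_complete (S : signature) (V : algebra_class S)
    (F : algebra S) : Prop :=
  forall q : quasi_identity S, admissible F q ->
    forall A : algebra S, V A -> holds_quasi_identity A q.

(* First-order formulas with equality; the remaining connectives and the
   existential quantifier are classically definable from these. *)
Inductive formula (S : signature) : Type :=
| FEq (s t : term S nat)
| FBot
| FImp (phi psi : formula S)
| FAll (n : nat) (phi : formula S).

Arguments FBot {S}.

Definition update (A : Type) (e : nat -> A) (n : nat) (a : A) : nat -> A :=
  fun m => if m == n then a else e m.

Fixpoint sat (S : signature) (A : algebra S) (e : nat -> A) (phi : formula S) :
    Prop :=
  match phi with
  | FEq s t => eval e s = eval e t
  | FBot => False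
  | FImp phi1 phi2 => sat e phi1 -> sat e phi2
  | FAll n phi1 => forall a : A, sat (update e n a) phi1
  end.

Definition elementary_embedding (S : signature) (A B : algebra S) (h : A -> B) :
    Prop :=
  forall (phi : formula S) (e : nat -> A),
    sat e phi <-> sat (fun n => h (e n)) phi.

(* Elementary extensions are taken up to isomorphism, that is, as elementary
   embeddings. *)
Definition has_elementary_extension_with_idempotent (S : signature)
    (F : algebra S) : Prop :=
  exists (M : algebra S) (h : F -> M),
    elementary_embedding h /\ exists e : M, idempotent_element e.

(* Main.v *)
From mathcomp Require Import all_boot.
From mathcomp Require Import boolp classical_sets filter.
Require Import Defs.

(** With a discriminator term one can switch by cases: there is a term
   operation [sw a b c d] which is [c] where [a = b] and [d] where [a <> b].
   Finite conjunctions of equations and implications between equations thus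
   become single equations on algebras carrying the discriminator, and those
   algebras detect everything: a set of pairs that is closed under switching
   and avoids the diagonal survives in a quotient that carries the
   discriminator, namely the quotient by a congruence maximal among those
   avoiding the set.

   If the premises of a quasi-identity are solvable in [A], any assignment into
   [A] can be switched to the solution where it violates the premises.  Hence an
   admissible quasi-identity whose premises are solvable in [F] holds in [V],
   and an idempotent element of an elementary extension makes all premises
   solvable.  If [V] is minimal, all its nontrivial members satisfy the
   same identities, so those carrying the discriminator satisfy the same
   quasi-identities; this makes the premises solvable in every nontrivial member
   and yields minimality as a quasivariety.

   Conversely, suppose [V] is structurally complete and [F] has no common
   idempotent for some finitely many operations, so that in nontrivial members
   an equation [u = v] in one variable expressing such an idempotent is never
   satisfied.  Then the negation of an identity [p = r] is itself an equation
   [sw p r u v = v], so its solvability passes from some member of [V] to [F]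
   and on to all members, and no nontrivial subvariety satisfies [p = r].  If
   all finite sets of operations do have common idempotents in [F], an
   ultrapower of [F] has an idempotent element. *)

Set Implicit Arguments.
Unset Strict Implicit.
Unset Printing Implicit Defensive.

(** * Substitution, homomorphisms and trivial algebras *)

Fixpoint subst (S : signature) (X Y : Type) (s : X -> term S Y)
    (t : term S X) : term S Y :=
  match t with
  | Var x => s x
  | App f args => App (fun i => subst s (args i))
  end.

Lemma eval_subst (S : signature) (X Y : Type) (A : algebra S) (e : Y -> A)
    (s : X -> term S Y) (t : term S X) :
  eval e (subst s t) = eval (fun x => eval e (s x)) t.
Proof.
by elim: t => //= f args IH; congr (interp _); apply: funext => i; exact: IH.
Qed.

Lemma hom_eval (S : signature) (X : Type) (A B : algebra S) (h : A -> B)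
    (e : X -> A) (t : term S X) :
  is_hom h -> h (eval e t) = eval (h \o e) t.
Proof.
move=> hh; elim: t => //= f args IH; rewrite hh.
by congr (interp _); apply: funext => i; exact: IH.
Qed.

Lemma eval_idempotent (S : signature) (X : Type) (A : algebra S) (a : A)
    (t : term S X) :
  idempotent_element a -> eval (fun _ => a) t = a.
Proof.
move=> ida; elim: t => //= f args IH; rewrite -[RHS](ida f).
by congr (interp _); apply: funext => i; exact: IH.
Qed.

Lemma hom_ternary (S : signature) (A B : algebra S) (h : A -> B)
    (t : term S 'I_3) (a b c : A) :
  is_hom h -> h (ternary_op t a b c) = ternary_op t (h a) (h b) (h c).
Proof.
move=> hh; rewrite /ternary_op hom_eval //; congr (eval _ _).
by apply: funext; case=> [[|[|[|]]]].
Qed.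

Lemma trivial_holds (S : signature) (A : algebra S) (p : identity S) :
  trivial_algebra A -> holds_identity A p.
Proof. by move=> trA e; exact: trA. Qed.

Lemma trivial_holds_quasi (S : signature) (A : algebra S)
    (q : quasi_identity S) :
  trivial_algebra A -> holds_quasi_identity A q.
Proof. by move=> trA e _; exact: trA. Qed.

Lemma hom_image_holds (S : signature) (A B : algebra S) (h : A -> B)
    (p : identity S) :
  is_hom h -> (forall b, exists a, h a = b) ->
  holds_identity A p -> holds_identity B p.
Proof.
move=> hh /choice[g hg] Ap e; rewrite /sat_identity.
have <- : h \o (g \o e) = e by apply: funext => n; rewrite /= hg.
by rewrite -!(hom_eval _ _ hh) Ap.
Qed.

Lemma variety_hom_image (S : signature) (V : algebra_class S)
    (A B : algebra S) (h : A -> B) :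
  is_variety V -> is_hom h -> (forall b, exists a, h a = b) -> V A -> V B.
Proof.
case=> E VE hh hs /VE VA; apply/VE => p Ep.
by apply: hom_image_holds (VA p Ep).
Qed.

(** * Quotients *)

Record congruence (S : signature) (A : algebra S) := Congruence {
  crel :> A -> A -> Prop;
  crel_refl : forall a, crel a a;
  crel_sym : forall a b, crel a b -> crel b a;
  crel_trans : forall a b c, crel a b -> crel b c -> crel a c;
  crel_interp : forall (f : op S) (a b : 'I_(arity f) -> A),
    (forall i, crel (a i) (b i)) -> crel (interp a) (interp b)
}.

Lemma quotient (S : signature) (A : algebra S) (th : congruence A) :
  exists (B : algebra S) (h : A -> B),
    [/\ is_hom h, forall b, exists a, h a = b
      & forall a b, h a = h b <-> th a b].
Proof.
pose Q := {c : A -> Prop | exists a, c = th a}.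
pose cls a : Q := exist _ (th a) (ex_intro _ a erefl).
have clsE a b : cls a = cls b <-> th a b.
  split=> [[->]|ab]; first exact: crel_refl.
  apply: eq_sig_hprop => [P|/=]; first exact: Prop_irrelevance.
  apply: funext => c; apply: propext; split.
    exact: crel_trans (crel_sym ab).
  exact: crel_trans ab.
have /choice[rep repE] (c : Q) : exists a, cls a = c.
  case: c => c [a ca]; exists a.
  by apply: eq_sig_hprop => //= P; exact: Prop_irrelevance.
have iQ : inhabited Q by case: (carrier_inhabited A) => a; exists; exact: cls a.
pose B := @Algebra S Q (fun f c => cls (interp (fun i => rep (c i)))) iQ.
exists B, cls; split=> //; last by move=> c; exists (rep c).
move=> f a; apply/clsE; apply: crel_interp => i.
by apply/clsE; rewrite repE.
Qed.

Definition eq_congruence (S : signature) (A : algebra S) : congruence A.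
Proof.
exists (@eq A) => //; first by move=> a b c ->.
by move=> f a b /funext->.
Defined.

(** As arities are finite, this makes the union of a chain of congruences compatible with the
    operations. *)
Lemma common_link (S : signature) (A : algebra S)
    (C : set (congruence A)) :
  (exists th, C th) ->
  total_on C (fun th th' => forall a b, th a b -> th' a b) ->
  forall n (a b : 'I_n -> A),
    (forall i, exists2 th, C th & th (a i) (b i)) ->
    exists2 th, C th & forall i, th (a i) (b i).
Proof.
move=> C0 Ctot n a b Cab.
suff /(_ (enum 'I_n))[th Cth abth] : forall s : seq 'I_n,
    exists2 th, C th & forall i, i \in s -> th (a i) (b i).
  by exists th => // i; apply: abth; rewrite mem_enum.
elim=> [|i s [th Cth abth]]; first by case: C0 => th Cth; exists th.
have [th' Cth' abth'] := Cab i.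
have [le|le] := Ctot _ _ Cth Cth'.
  by exists th' => // j /[!inE] /predU1P[->//|/abth/le].
by exists th => // j /[!inE] /predU1P[->|/abth//]; exact: le.
Qed.

Lemma maximal_congruence (S : signature) (A : algebra S)
    (P : A -> A -> Prop) :
  (forall a, ~ P a a) ->
  exists th : congruence A,
    (forall a b, P a b -> ~ th a b) /\
    forall th' : congruence A,
      (forall a b, th a b -> th' a b) ->
      (forall a b, P a b -> ~ th' a b) ->
      forall a b, th' a b -> th a b.
Proof.
move=> P0.
pose T := {th : congruence A | forall a b, P a b -> ~ th a b}.
have t0 : T.
  exists (eq_congruence A) => a b Pab /= ab.
  by apply: (P0 a); rewrite [X in P _ X]ab.
pose le (s t : T) := `[< forall a b, sval s a b -> sval t a b >].
have le_refl s : le s s by apply/asboolP.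
have le_trans r s t : le r s -> le s t -> le r t.
  by move=> /asboolP rs /asboolP st; apply/asboolP => a b /rs/st.
have [C Ctot|[th thP] thmax] := ZL_preorder t0 le_refl le_trans.
  have [C0|/forallNP C0] := pselect (exists s, C s); last first.
    by exists t0 => s /C0.
  pose D : set (congruence A) := fun th => exists2 s, C s & sval s = th.
  have D0 : exists th, D th by case: C0 => s Cs; exists (sval s), s.
  have Dtot : total_on D (fun th th' => forall a b, th a b -> th' a b).
    move=> _ _ [s Cs <-] [s' Cs' <-].
    by have [/asboolP|/asboolP] := Ctot _ _ Cs Cs'; [left|right].
  pose U a b := exists2 th, D th & crel th a b.
  have Urefl a : U a a by case: D0 => th Dth; exists th => //; apply: crel_refl.
  have Usym a b : U a b -> U b a.
    by case=> th Dth ab; exists th => //; apply: crel_sym.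
  have Utrans a b c : U a b -> U b c -> U a c.
    move=> [th Dth ab] [th' Dth' bc].
    have [le1|le1] := Dtot _ _ Dth Dth'.
      by exists th' => //; apply: crel_trans (le1 _ _ ab) bc.
    by exists th => //; apply: crel_trans ab (le1 _ _ bc).
  have Uinterp (f : op S) (a b : 'I_(arity f) -> A) :
      (forall i, U (a i) (b i)) -> U (interp a) (interp b).
    move=> /(common_link D0 Dtot)[th Dth ab].
    by exists th => //; apply: crel_interp.
  have UP a b : P a b -> ~ U a b.
    by move=> Pab [_ [[th thP] _ <-]]; exact: thP.
  exists (exist _ (Congruence Urefl Usym Utrans Uinterp) UP) => s Cs.
  by apply/asboolP => a b sab; exists (sval s) => //; exists s.
exists th; split=> // th' th_th' th'P.
by apply/asboolP/(thmax (exist _ th' th'P))/asboolP.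
Qed.

Lemma maximal_quotient (S : signature) (A : algebra S) (P : A -> A -> Prop) :
  (forall a, ~ P a a) ->
  exists (B : algebra S) (h : A -> B),
    [/\ is_hom h, forall b, exists a, h a = b,
        forall a b, P a b -> h a <> h b
      & forall th : congruence B, (forall a b, P a b -> ~ th (h a) (h b)) ->
          forall c d, th c d -> c = d].
Proof.
move=> /maximal_congruence[th [thP thmax]].
have [B [h [hh hs hE]]] := quotient th.
exists B, h; split=> // [a b Pab /hE|th' th'P c d]; first exact: thP.
have [[{}c <-] [{}d <-]] := (hs c, hs d) => cd; apply/hE.
(* The pullback of [th'] along [h] contains [th], so maximality applies to it. *)
pose R a b := th' (h a) (h b).
have Rrefl a : R a a by exact: crel_refl.
have Rsym a b : R a b -> R b a by exact: crel_sym.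
have Rtrans a b g : R a b -> R b g -> R a g by exact: crel_trans.
have Rinterp (f : op S) (a b : 'I_(arity f) -> A) :
    (forall i, R (a i) (b i)) -> R (interp a) (interp b).
  by move=> ab; rewrite /R !hh; apply: crel_interp.
apply: (thmax (Congruence Rrefl Rsym Rtrans Rinterp)) => //= a b /hE ab.
by rewrite /R ab; exact: crel_refl.
Qed.

(** * Discriminator terms *)

(** Where [t] is the discriminator: if [a = b], this is [t c d d], which is [c] even when [c = d];
    if [a <> b], it is [t a a d], which is [d]. *)
Definition sw (S : signature) (A : algebra S) (t : term S 'I_3) (a b c d : A) :
    A :=
  ternary_op t (ternary_op t a b c) (ternary_op t a b d) d.

Definition tern_term (S : signature) (t : term S 'I_3) (a b c : term S nat) :
    term S nat :=
  subst (tnth [tuple a; b; c]) t.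

Definition sw_term (S : signature) (t : term S 'I_3) (a b c d : term S nat) :
    term S nat :=
  tern_term t (tern_term t a b c) (tern_term t a b d) d.

Lemma eval_tern_term (S : signature) (A : algebra S) (t : term S 'I_3)
    (e : nat -> A) (a b c : term S nat) :
  eval e (tern_term t a b c) =
  ternary_op t (eval e a) (eval e b) (eval e c).
Proof.
rewrite eval_subst /ternary_op; congr (eval _ _).
by apply: funext; case=> [[|[|[|]]]].
Qed.

Lemma eval_sw_term (S : signature) (A : algebra S) (t : term S 'I_3)
    (e : nat -> A) (a b c d : term S nat) :
  eval e (sw_term t a b c d) =
  sw t (eval e a) (eval e b) (eval e c) (eval e d).
Proof. by rewrite /sw_term !eval_tern_term. Qed.

Lemma hom_sw (S : signature) (A B : algebra S) (h : A -> B)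
    (t : term S 'I_3) (a b c d : A) :
  is_hom h -> h (sw t a b c d) = sw t (h a) (h b) (h c) (h d).
Proof. by move=> hh; rewrite /sw !hom_ternary. Qed.

Lemma disc_sw_eq (S : signature) (A : algebra S) (t : term S 'I_3)
    (a c d : A) :
  is_discriminator (@ternary_op S A t) -> sw t a a c d = c.
Proof.
move=> tA; rewrite /sw !(proj2 (tA a a _) erefl).
have [->|cd] := pselect (c = d); first exact: (proj2 (tA _ _ _)).
exact: (proj1 (tA _ _ _)).
Qed.

Lemma disc_sw_neq (S : signature) (A : algebra S) (t : term S 'I_3)
    (a b c d : A) :
  is_discriminator (@ternary_op S A t) -> a <> b -> sw t a b c d = d.
Proof.
move=> tA ab; rewrite /sw !(proj1 (tA a b _) ab).
exact: (proj2 (tA _ _ _)).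
Qed.

Section DiscriminatorVariety.
Variables (S : signature) (V : algebra_class S) (t : term S 'I_3).

Definition discriminator_identities : Prop :=
  forall p : identity S,
    (forall A : algebra S, is_discriminator (@ternary_op S A t) ->
       holds_identity A p) ->
    forall A : algebra S, V A -> holds_identity A p.

Hypothesis Vvar : is_variety V.
Hypothesis Vt : discriminator_identities.

(** * Identities of the switching operation *)

Section Identities.
Variables (A : algebra S) (VA : V A).
Implicit Types a b c d w : A.

Let v : nat -> term S nat := @Var S nat.

Let evalE := (@eval_sw_term S, @eval_tern_term S).

(** The case distinction on variables 0 and 1 takes place in algebras carrying the discriminator,
    which [A] itself need not do. *)
Lemma transfer (l r : term S nat) (e : nat -> A) :
  (forall B : algebra S, is_discriminator (@ternary_op S B t) ->
     forall e : nat -> B, e 0 = e 1 -> eval e l = eval e r) ->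
  (forall B : algebra S, is_discriminator (@ternary_op S B t) ->
     forall e : nat -> B, e 0 <> e 1 -> eval e l = eval e r) ->
  eval e l = eval e r.
Proof.
move=> eq01 neq01; apply: (@Vt (Identity l r)) => // B tB e'.
by have [|] := pselect (e' 0 = e' 1); [apply: eq01|apply: neq01].
Qed.

Lemma sw_same a c d : sw t a a c d = c.
Proof.
have := @transfer
  (sw_term t (v 0) (v 0) (v 1) (v 2))
  (v 1)
  (nth a [:: a; c; d]).
rewrite !evalE /=; apply=> B tB {}e e01; rewrite !evalE /=.
  by rewrite ?(disc_sw_eq _ _ _ tB).
by rewrite (disc_sw_eq _ _ _ tB).
Qed.

Lemma tern_sw a b c : ternary_op t a b c = sw t a b c a.
Proof.
have := @transfer
  (tern_term t (v 0) (v 1) (v 2))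
  (sw_term t (v 0) (v 1) (v 2) (v 0))
  (nth a [:: a; b; c]).
rewrite !evalE /=; apply=> B tB {}e e01; rewrite !evalE /=.
  by rewrite e01 ?(disc_sw_eq _ _ _ tB) (proj2 (tB _ _ _)).
by rewrite ?(disc_sw_neq _ _ tB) // (proj1 (tB _ _ _)).
Qed.

Lemma tern_same a c : ternary_op t a a c = c.
Proof. by rewrite tern_sw sw_same. Qed.

Lemma sw_const a b c : sw t a b c c = c.
Proof.
have := @transfer
  (sw_term t (v 0) (v 1) (v 2) (v 2))
  (v 2)
  (nth a [:: a; b; c]).
rewrite !evalE /=; apply=> B tB {}e e01; rewrite !evalE /=.
  by rewrite e01 ?(disc_sw_eq _ _ _ tB).
by rewrite ?(disc_sw_neq _ _ tB).
Qed.

Lemma sw_swl a b c d w : sw t a b (sw t a b c d) w = sw t a b c w.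
Proof.
have := @transfer
  (sw_term t (v 0) (v 1) (sw_term t (v 0) (v 1) (v 2) (v 3)) (v 4))
  (sw_term t (v 0) (v 1) (v 2) (v 4))
  (nth a [:: a; b; c; d; w]).
rewrite !evalE /=; apply=> B tB {}e e01; rewrite !evalE /=.
  by rewrite e01 ?(disc_sw_eq _ _ _ tB).
by rewrite ?(disc_sw_neq _ _ tB).
Qed.

Lemma sw_swr a b c d w : sw t a b w (sw t a b c d) = sw t a b w d.
Proof.
have := @transfer
  (sw_term t (v 0) (v 1) (v 4) (sw_term t (v 0) (v 1) (v 2) (v 3)))
  (sw_term t (v 0) (v 1) (v 4) (v 3))
  (nth a [:: a; b; c; d; w]).
rewrite !evalE /=; apply=> B tB {}e e01; rewrite !evalE /=.
  by rewrite e01 ?(disc_sw_eq _ _ _ tB).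
by rewrite ?(disc_sw_neq _ _ tB).
Qed.

Lemma sw_eq a b w : sw t a b a w = sw t a b b w.
Proof.
have := @transfer
  (sw_term t (v 0) (v 1) (v 0) (v 2))
  (sw_term t (v 0) (v 1) (v 1) (v 2))
  (nth a [:: a; b; w]).
rewrite !evalE /=; apply=> B tB {}e e01; rewrite !evalE /=.
  by rewrite e01 ?(disc_sw_eq _ _ _ tB).
by rewrite ?(disc_sw_neq _ _ tB).
Qed.

Lemma sw_tern1 a b c : sw t a b b (ternary_op t a b c) = a.
Proof.
have := @transfer
  (sw_term t (v 0) (v 1) (v 1) (tern_term t (v 0) (v 1) (v 2)))
  (v 0)
  (nth a [:: a; b; c]).
rewrite !evalE /=; apply=> B tB {}e e01; rewrite !evalE /=.
  by rewrite e01 ?(disc_sw_eq _ _ _ tB).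
by rewrite ?(disc_sw_neq _ _ tB) // (proj1 (tB _ _ _)).
Qed.

Lemma sw_tern2 a b c : sw t a b b (ternary_op t b a c) = b.
Proof.
have := @transfer
  (sw_term t (v 0) (v 1) (v 1) (tern_term t (v 1) (v 0) (v 2)))
  (v 1)
  (nth a [:: a; b; c]).
rewrite !evalE /=; apply=> B tB {}e e01; rewrite !evalE /=.
  by rewrite e01 ?(disc_sw_eq _ _ _ tB).
by rewrite ?(disc_sw_neq _ _ tB) // (proj1 (tB _ _ _)) // => /esym.
Qed.

(** [sw t a b b] maps the left side to [a] and the right side to [b], so equal sides force [a = b],
    and then they reduce to [c] and [d]. *)
Lemma tern_conj a b c d :
  ternary_op t a b c = ternary_op t b a d <-> a = b /\ c = d.
Proof.
split=> [E|[-> ->]]; last by rewrite !tern_same.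
have ab : a = b by rewrite -(sw_tern1 a b c) E sw_tern2.
by move: E; rewrite ab !tern_same.
Qed.

(** For fixed [a] and [b], switching is a homomorphism from the square of [A], being a projection
    wherever [t] is the discriminator. *)
Lemma sw_eval a b (e1 e2 : nat -> A) (s : term S nat) :
  sw t a b (eval e1 s) (eval e2 s) = eval (fun n => sw t a b (e1 n) (e2 n)) s.
Proof.
(* Variables 0 and 1 carry [a] and [b], the other even ones [e1], the other odd ones [e2]. *)
pose e n := if n is n'.+2 then (if odd n' then e2 else e1) n'./2
            else if n is 1 then b else a.
pose s1 := subst (fun n => v n.*2.+2) s.
pose s2 := subst (fun n => v n.*2.+3) s.
have := @transfer (sw_term t (v 0) (v 1) s1 s2)
  (subst (fun n => sw_term t (v 0) (v 1) (v n.*2.+2) (v n.*2.+3)) s) e.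
rewrite evalE !eval_subst /=.
have -> : (fun n => eval e (sw_term t (v 0) (v 1) (v n.*2.+2) (v n.*2.+3))) =
          (fun n => sw t a b (e1 n) (e2 n)).
  by apply: funext => n; rewrite evalE /= odd_double uphalf_double doubleK.
have -> : (fun n => e n.*2.+2) = e1.
  by apply: funext => n; rewrite /= odd_double doubleK.
have -> : (fun n => e n.*2.+3) = e2.
  by apply: funext => n; rewrite /= odd_double uphalf_double.
apply=> B tB {}e e01; rewrite evalE !eval_subst /=.
  rewrite e01 disc_sw_eq //; congr (eval _ s).
  by apply: funext => n; rewrite evalE /= e01 disc_sw_eq.
rewrite disc_sw_neq //; congr (eval _ s).
by apply: funext => n; rewrite evalE /= disc_sw_neq.
Qed.

Lemma sw_interp a b (f : op S) (x y : 'I_(arity f) -> A) :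
  sw t a b (interp x) (interp y) = interp (fun i => sw t a b (x i) (y i)).
Proof.
pose ext (z : 'I_(arity f) -> A) n := if insub n is Some i then z i else a.
have extE z (i : 'I_(arity f)) : ext z i = z i by rewrite /ext valK.
pose s := App (fun i : 'I_(arity f) => v i).
have sE z : eval (ext z) s = interp z.
  by congr (interp _); apply: funext => i; rewrite /= extE.
rewrite -[in LHS]sE -[in LHS](sE y) sw_eval.
by congr (interp _); apply: funext => i; rewrite /= !extE.
Qed.

(* The principal congruence of [(a, b)]. *)
Lemma congruence_swr a b :
  exists th : congruence A,
    forall c d, th c d <-> forall w, sw t a b w c = sw t a b w d.
Proof.
pose R c d := forall w, sw t a b w c = sw t a b w d.
have Rrefl c : R c c by [].
have Rsym c d : R c d -> R d c by move=> cd w.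
have Rtrans c d g : R c d -> R d g -> R c g by move=> cd dg w; rewrite cd.
suff Rinterp (f : op S) (x y : 'I_(arity f) -> A) :
    (forall i, R (x i) (y i)) -> R (interp x) (interp y).
  by exists (Congruence Rrefl Rsym Rtrans Rinterp).
move=> xy w.
(* Padding with the value at the constant tuple [w] lets [sw_interp] move the switch to the
   arguments. *)
rewrite -(sw_swr a b (interp (fun _ : 'I_(arity f) => w)) (interp x) w).
rewrite -(sw_swr a b (interp (fun _ : 'I_(arity f) => w)) (interp y) w).
rewrite !sw_interp.
by congr (sw _ _ _ _ (interp _)); apply: funext => i; exact: xy.
Qed.

(* The complement of the principal congruence of [(a, b)]. *)
Lemma congruence_swl a b :
  exists th : congruence A,
    forall c d, th c d <-> forall w, sw t a b c w = sw t a b d w.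
Proof.
pose R c d := forall w, sw t a b c w = sw t a b d w.
have Rrefl c : R c c by [].
have Rsym c d : R c d -> R d c by move=> cd w.
have Rtrans c d g : R c d -> R d g -> R c g by move=> cd dg w; rewrite cd.
suff Rinterp (f : op S) (x y : 'I_(arity f) -> A) :
    (forall i, R (x i) (y i)) -> R (interp x) (interp y).
  by exists (Congruence Rrefl Rsym Rtrans Rinterp).
move=> xy w.
rewrite -(sw_swl a b (interp x) (interp (fun _ : 'I_(arity f) => w)) w).
rewrite -(sw_swl a b (interp y) (interp (fun _ : 'I_(arity f) => w)) w).
rewrite !sw_interp.
by congr (sw _ _ _ (interp _) _); apply: funext => i; exact: xy.
Qed.

End Identities.

(** By maximality, each congruence of [B] other than equality identifies a pair from [P]. If
    agreement where [a = b] and agreement where [a <> b] both did so, switching the two pairs would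
    yield a pair of [P] collapsed by [h]. *)
Lemma discriminator_quotient (A : algebra S) (P : A -> A -> Prop) :
  V A -> (forall a, ~ P a a) ->
  (forall a b u v u' v', P u v -> P u' v' ->
     P (sw t a b u u') (sw t a b v v')) ->
  exists (B : algebra S) (h : A -> B),
    [/\ V B, is_discriminator (@ternary_op S B t), is_hom h,
        forall b, exists a, h a = b
      & forall u v, P u v -> h u <> h v].
Proof.
move=> VA /maximal_quotient[B [h [hh hs hP hmax]]] Psw.
have VB : V B by exact: variety_hom_image VA.
exists B, h; split=> // a b c; split=> [ab|->]; last exact: tern_same.
(* [th1] is agreement where [a = b] and contains [(a, b)]; in fact it is the congruence this pair
   generates. *)
have [th1 th1E] := congruence_swl VB a b.
have [u [v [Puv uv]]] : exists u v, P u v /\ th1 (h u) (h v).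
  apply: contrapT => nP; apply: ab; apply: (hmax th1) => [u v Puv uv|].
    by apply: nP; exists u, v.
  by apply/th1E => w; exact: sw_eq.
(* [th2] is agreement where [a <> b] and contains [(ternary_op t a b c, a)]. *)
have [th2 th2E] := congruence_swr VB a b.
apply: (hmax th2) => [u' v' Pu'v' u'v'|]; last first.
  by apply/th2E => w; rewrite tern_sw // sw_swr.
have [[a' aE] [b' bE]] := (hs a, hs b).
apply: (hP _ _ (Psw a' b' _ _ _ _ Puv Pu'v')); rewrite !hom_sw // aE bE.
by rewrite (proj1 (th1E _ _) uv) (proj1 (th2E _ _) u'v').
Qed.

(** * Conjunctions of premises and patching of assignments *)

Fixpoint conj_identities (I : Type) (p : I -> identity S) (s : seq I) :
    identity S :=
  if s is i :: s' then
    let q := conj_identities p s' in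
    Identity (tern_term t (lhs (p i)) (rhs (p i)) (lhs q))
             (tern_term t (rhs (p i)) (lhs (p i)) (rhs q))
  else Identity (Var S 0) (Var S 0).

Definition conj_premises (q : quasi_identity S) : identity S :=
  conj_identities (@premise S q) (enum 'I_(premise_count q)).

Lemma sat_conj_premises (A : algebra S) (q : quasi_identity S) (e : nat -> A) :
  V A ->
  sat_identity e (conj_premises q) <->
  (forall i : 'I_(premise_count q), sat_identity e (premise i)).
Proof.
move=> VA; have conjP (s : seq 'I_(premise_count q)) :
    sat_identity e (conj_identities (@premise S q) s) <->
    (forall i, i \in s -> sat_identity e (premise i)).
  elim: s => [|i s IH]; first by split.
  rewrite /sat_identity /= !eval_tern_term (tern_conj VA).
  split=> [[pi /IH ps] j /[!inE] /predU1P[->|/ps]//|ps].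
  split; first by apply: ps; rewrite mem_head.
  by apply/IH => j js; apply: ps; rewrite inE js orbT.
by split=> [/conjP pq i|pq]; [apply: pq; rewrite mem_enum|apply/conjP => i _].
Qed.

(* If the premises hold at [e0], then switching between [e] and [e0] according
   to whether they hold at [e] gives an assignment at which they always hold. *)
Lemma quasi_identity_patch (A B : algebra S) (h : A -> B)
    (q : quasi_identity S) (e0 e : nat -> A) :
  V A -> V B -> is_hom h -> holds_quasi_identity A q ->
  (forall i : 'I_(premise_count q), sat_identity e0 (premise i)) ->
  (forall i : 'I_(premise_count q), sat_identity (h \o e) (premise i)) ->
  sat_identity (h \o e) (conclusion q).
Proof.
move=> VA VB hh Aq /sat_conj_premises -/(_ VA) pe0.
move=> /sat_conj_premises -/(_ VB) pe.
set p := conj_premises q in pe0 pe.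
pose e' n := sw t (eval e (lhs p)) (eval e (rhs p)) (e n) (e0 n).
have /Aq : forall i : 'I_(premise_count q), sat_identity e' (premise i).
  apply/sat_conj_premises => //; rewrite /sat_identity -!sw_eval //.
  by rewrite pe0; exact: sw_eq.
suff <- : h \o e' = h \o e.
  by rewrite /sat_identity -!(hom_eval _ _ hh) => ->.
by apply: funext => n; rewrite /= hom_sw // !hom_eval // pe sw_same.
Qed.


End DiscriminatorVariety.

(** * Ultrapowers *)

Section Ultrapowers.
Local Open Scope classical_set_scope.

Lemma power_inhabited (S : signature) (I : Type) (A : algebra S) :
  inhabited (I -> A).
Proof. by case: (carrier_inhabited A) => a; exists. Qed.

Definition power (S : signature) (I : Type) (A : algebra S) : algebra S :=
  Algebra (fun f (a : 'I_(arity f) -> I -> A) i => interp (fun k => a k i))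
    (power_inhabited I A).

Lemma eval_power (S : signature) (I : Type) (A : algebra S)
    (e : nat -> power I A) (s : term S nat) (i : I) :
  eval e s i = eval (fun n => e n i) s.
Proof. exact: (@hom_eval _ _ (power I A) A (fun a => a i)). Qed.

(** Los's theorem. For [FImp] it matters that an ultrafilter decides every set, for [FAll] that
    counterexamples can be chosen coordinatewise. *)
Lemma ultrapower (S : signature) (I : Type) (A : algebra S) (U : set_system I) :
  UltraFilter U ->
  exists (M : algebra S) (h : power I A -> M),
    [/\ is_hom h,
        forall a b : I -> A, h a = h b <-> U [set i | a i = b i]
      & forall (phi : formula S) (e : nat -> power I A),
          sat (h \o e) phi <-> U [set i | sat (fun n => e n i) phi]].
Proof.
move=> UU; pose R (a b : power I A) := U [set i | a i = b i].
have Rrefl a : R a a by apply: filterS filterT.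
have Rsym a b : R a b -> R b a by apply: filterS => i.
have Rtrans a b c : R a b -> R b c -> R a c.
  by move=> ab bc; apply: filterS (filterI ab bc) => i [/= -> ->].
have Rinterp (f : op S) (a b : 'I_(arity f) -> power I A) :
    (forall k, R (a k) (b k)) -> R (interp a) (interp b).
  move=> ab; have : U [set i | forall k, a k i = b k i].
    suff : forall s : seq 'I_(arity f),
        U [set i | forall k, k \in s -> a k i = b k i].
      move=> /(_ (enum 'I_(arity f))); apply: filterS => i ki k.
      by apply: ki; rewrite mem_enum.
    elim=> [|k s IH]; first by apply: filterS filterT.
    apply: filterS (filterI (ab k) IH) => i [/= ki si] j /[!inE].
    by move=> /predU1P[->//|/si].
  by apply: filterS => i /= ki; congr (interp _); apply: funext.
have [M [h [hh hs hE]]] := quotient (Congruence Rrefl Rsym Rtrans Rinterp).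
exists M, h; split=> //; elim=> [s1 s2|//|phi1 IH1 phi2 IH2|n phi IH] e /=.
- rewrite -!(hom_eval _ _ hh) hE /= /R.
  by split; apply: filterS => i /=; rewrite !eval_power.
- by split=> // U0; apply: (@filter_not_empty _ U).
- rewrite IH1 IH2; split=> [U12|U12 U1].
    have [U1|U1] := in_ultra_setVsetC [set i | sat (fun n => e n i) phi1] UU.
      by apply: filterS (U12 U1) => i /= s2 _.
    by apply: filterS U1 => i /= ns1 /ns1.
  by apply: filterS (filterI U1 U12) => i [/= + s12]; exact: s12.
have upd (a : power I A) : update (h \o e) n (h a) = h \o update e n a.
  by apply: funext => m; rewrite /update /=; case: eqP.
have updi (a : power I A) i :
    (fun m => update e n a m i) = update (fun m => e m i) n (a i).
  by apply: funext => m; rewrite /update; case: eqP.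
split=> [all|Uall m]; last first.
  have [a <-] := hs m; rewrite upd IH; apply: filterS Uall => i /=.
  by rewrite updi.
pose bad i a := ~ sat (update (fun m => e m i) n a) phi.
have /choice[a aP] i : exists a, (exists a, bad i a) -> bad i a.
  have [[a na]|no] := pselect (exists a, bad i a); first by exists a.
  by case: (carrier_inhabited A) => a; exists a.
have := all (h a); rewrite upd IH; apply: filterS => i /=; rewrite updi => ai b.
by apply: contrapT => nb; apply: (aP i) => //; exists b.
Qed.

Definition idempotent_for (S : signature) (A : algebra S) n (f : 'I_n -> op S)
    (a : A) : Prop :=
  forall i, interp (fun _ : 'I_(arity (f i)) => a) = a.

(* The index set of the ultrapower is [A] itself, and the identity map of [A]
   represents the idempotent element. *)
Lemma extension_with_idempotent (S : signature) (A : algebra S) :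
  (forall n (f : 'I_n -> op S), exists a : A, idempotent_for f a) ->
  has_elementary_extension_with_idempotent A.
Proof.
move=> idA.
pose G : set_system A := fun X => exists n (f : 'I_n -> op S),
  forall a, idempotent_for f a -> X a.
have : ProperFilter G.
  split=> [[n [f f0]]|]; first by have [a /f0] := idA n f.
  split=> [|X Y [n [f fX]] [m [g gY]]|X Y XY [n [f fX]]].
  - by exists 0, (fun i : 'I_0 => False_rect _ (notF (ltn_ord i))).
  - pose fg (i : 'I_(n + m)) :=
      match split i with inl j => f j | inr j => g j end.
    exists (n + m), fg => a ida; split; [apply: fX|apply: gY] => i.
      by have := ida (unsplit (inl i)); rewrite /fg unsplitK.
    by have := ida (unsplit (inr i)); rewrite /fg unsplitK.
  - by exists n, f => a /fX /XY.
move=> /ultraFilterLemma[U [UU GU]].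
have [M [h [hh hE los]]] := ultrapower A UU.
exists M, (fun a => h (fun=> a)); split.
  move=> phi e; rewrite (los phi (fun n _ => e n)); split=> [sate|].
    by apply: filterS filterT.
  by move=> Usat; have [i] := filter_ex Usat.
exists (h id) => f; rewrite -hh; apply/hE; apply: GU.
by exists 1, (fun=> f) => a /(_ ord0).
Qed.

End Ultrapowers.

(** * Varieties and free algebras *)

(** At an idempotent element all terms take the same value, and unsolvability of [p] by a constant
    assignment is a first-order sentence. *)
Lemma constant_solution (S : signature) (A : algebra S) (p : identity S) :
  has_elementary_extension_with_idempotent A ->
  exists a : A, sat_identity (fun _ => a) p.
Proof.
move=> [M [h [hel [m idm]]]]; apply: contrapT => /forallNP noa.
pose c (s : term S nat) := subst (fun _ => Var S 0) s.
pose phi := FAll 0 (FImp (FEq (c (lhs p)) (c (rhs p))) (@FBot S)).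
case: (carrier_inhabited A) => a0.
have /hel /(_ m) : sat (fun _ => a0) phi.
  by move=> a /=; rewrite !eval_subst; exact: noa.
by case=> /=; rewrite !eval_subst !eval_idempotent.
Qed.

Lemma variety_quasivariety (S : signature) (V : algebra_class S) :
  is_variety V -> is_quasivariety V.
Proof.
case=> E VE.
exists (fun q => E (conclusion q) /\ premise_count q = 0) => A.
split=> [/VE VA q [Eq _] e _|VA]; first exact: VA.
apply/VE => p Ep e.
have q0 : 'I_0 -> identity S by case.
by apply: (VA (QuasiIdentity q0 p)) => // -[].
Qed.

Lemma subvariety (S : signature) (V : algebra_class S) (p : identity S) :
  is_variety V -> is_variety (fun A => V A /\ holds_identity A p).
Proof.
case=> E VE; exists (fun p' => E p' \/ p' = p) => A.
split=> [[/VE VA Ap] p' [/VA|->]//|VA].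
by split; [apply/VE => p' Ep'; apply: VA; left|apply: VA; right].
Qed.

Lemma variety_trivial (S : signature) (V : algebra_class S) (A : algebra S) :
  is_variety V -> trivial_algebra A -> V A.
Proof. by case=> E VE trA; apply/VE => p _; exact: trivial_holds. Qed.

Lemma quasivariety_trivial (S : signature) (V : algebra_class S)
    (A : algebra S) :
  is_quasivariety V -> trivial_algebra A -> V A.
Proof. by case=> E VE trA; apply/VE => q _; exact: trivial_holds_quasi. Qed.

Lemma trivial_class_variety (S : signature) (W : algebra_class S) :
  is_trivial_class W -> is_variety W.
Proof.
move=> trW; pose p := Identity (Var S 0) (Var S 1); exists (eq p) => A.
rewrite trW; split=> [trA _ <-|Ap a b]; first exact: trivial_holds.
exact: (Ap p erefl (nth a [:: a; b])).
Qed.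

Lemma free_trivial (S : signature) (V : algebra_class S) (F : algebra S)
    (x : nat -> F) :
  is_free_denumerable V x -> trivial_algebra F ->
  subclass V (@trivial_algebra S).
Proof.
move=> [_ univ] trF A VA a b.
have [h [_ hx _]] := univ A VA (nth a [:: a; b]).
by rewrite -[a](hx 0) -[b](hx 1) (trF (x 0) (x 1)).
Qed.

Lemma minimal_variety_identity (S : signature) (V : algebra_class S)
    (A : algebra S) (p : identity S) :
  minimal_variety V -> V A -> ~ trivial_algebra A -> holds_identity A p ->
  forall B : algebra S, V B -> holds_identity B p.
Proof.
move=> [Vvar Vmin] VA ntA Ap B VB; apply: contrapT => nBp.
have /Vmin/proj1 trW := subvariety p Vvar.
apply/ntA/trW => //; split=> [C []//|VW].
by apply: nBp; case: (VW B VB).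
Qed.

Lemma minimal_quasivariety_variety (S : signature) (V : algebra_class S) :
  is_variety V -> minimal_quasivariety V -> minimal_variety V.
Proof.
by move=> Vvar [_ Vmin]; split=> // W /variety_quasivariety; exact: Vmin.
Qed.

(** * Minimality and structural completeness *)

Section Minimal.
Variables (S : signature) (V : algebra_class S) (t : term S 'I_3).
Hypothesis Vt : discriminator_identities V t.

(** If the premises were unsolvable in [A], they would be unsolvable in a quotient of [A] carrying
    the discriminator, where unsolvability is an identity; minimality would carry it over to [B]. *)
Lemma minimal_variety_solvable (A B : algebra S) (q : quasi_identity S)
    (e : nat -> B) :
  minimal_variety V -> V A -> V B ->
  ~ trivial_algebra A -> ~ trivial_algebra B ->
  (forall i : 'I_(premise_count q), sat_identity e (premise i)) ->
  exists e' : nat -> A,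
    forall i : 'I_(premise_count q), sat_identity e' (premise i).
Proof.
move=> Vmin VA VB ntA ntB /(sat_conj_premises Vt _ _ VB).
set p := conj_premises t q => pe.
suff [e' pe'] : exists e' : nat -> A, sat_identity e' p.
  by exists e'; apply/(sat_conj_premises Vt _ _ VA).
apply: contrapT => /forallNP nosol.
pose P u v := exists e' : nat -> A, u = eval e' (lhs p) /\ v = eval e' (rhs p).
have P0 a : ~ P a a.
  by move=> [e' [aE aE']]; apply: (nosol e'); rewrite /sat_identity -aE.
have Psw a b u v u' v' : P u v -> P u' v' ->
    P (sw t a b u u') (sw t a b v v').
  move=> [e1 [-> ->]] [e2 [-> ->]].
  by exists (fun n => sw t a b (e1 n) (e2 n)); rewrite !(sw_eval Vt).
have [C [h [VC Ct hh hs hP]]] :=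
  discriminator_quotient (proj1 Vmin) Vt VA P0 Psw.
have nosolC e' : ~ sat_identity (e' : nat -> C) p.
  have /choice[g gE] := hs.
  have <- : h \o (g \o e') = e' by apply: funext => n; rewrite /= gE.
  rewrite /sat_identity -!(hom_eval _ _ hh); apply: hP.
  by exists (g \o e').
have ntC : ~ trivial_algebra C.
  case: (carrier_inhabited C) => c trC.
  exact: (nosolC (fun _ => c) (trC _ _)).
(* Shifting the variables frees 0 and 1 for two arbitrary elements, which [p'] identifies at any
   solution of [p]. *)
pose up (s : term S nat) := subst (fun n => Var S n.+2) s.
pose p' := Identity
  (sw_term t (up (lhs p)) (up (rhs p)) (Var S 0) (Var S 1)) (Var S 1).
have Cp' : holds_identity C p'.
  move=> e'; rewrite /sat_identity /= eval_sw_term !eval_subst /=.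
  by rewrite (disc_sw_neq _ _ Ct) //; exact: nosolC.
apply: ntB => y z.
have := minimal_variety_identity Vmin VC ntC Cp' VB
  (fun n => if n is n'.+2 then e n' else if n is 1 then z else y).
rewrite /sat_identity /= eval_sw_term !eval_subst /=.
by rewrite pe (sw_same Vt).
Qed.

(** A quasi-identity of a nontrivial [A] in [W] whose premises are solvable in [A] passes to a
    nontrivial quotient carrying the discriminator, where it amounts to an identity; minimality
    spreads this identity over [V]. *)
Lemma minimal_variety_quasivariety :
  minimal_variety V -> minimal_quasivariety V.
Proof.
move=> Vmin; have [Vvar Vmin2] := Vmin.
split=> [|W Wqvar]; first exact: variety_quasivariety.
split=> [[WV VW]|trW]; last first.
  exact/(Vmin2 W (trivial_class_variety trW)).
move=> A; split=> [WA|]; last exact: quasivariety_trivial.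
apply: contrapT => ntA; apply: VW => B VB.
have VA := WV A WA.
have [E WE] := Wqvar; apply/WE => q Eq e pe.
have Aq : holds_quasi_identity A q by move/WE: WA => /(_ q Eq).
apply: contrapT => nBq.
have ntB : ~ trivial_algebra B by move=> trB; apply: nBq; exact: trB.
have [e0 pe0] := minimal_variety_solvable Vmin VA VB ntA ntB pe.
have /existsNP[a /existsNP[b ab]] := ntA.
have [||C [h [VC Ct hh hs hP]]] := discriminator_quotient
  (P := fun u v => u = a /\ v = b) Vvar Vt VA.
- by move=> c [-> ].
- by move=> c d u v u' v' [-> ->] [-> ->]; rewrite !(sw_const Vt).
have ntC : ~ trivial_algebra C by move=> trC; apply: (hP a b) => //; exact: trC.
set p := conj_premises t q.
pose p' := Identity
  (sw_term t (lhs p) (rhs p) (lhs (conclusion q)) (rhs (conclusion q)))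
  (rhs (conclusion q)).
suff Cp' : holds_identity C p'.
  apply: nBq; have := minimal_variety_identity Vmin VC ntC Cp' VB e.
  rewrite /sat_identity /= eval_sw_term.
  by rewrite (proj2 (sat_conj_premises Vt _ _ VB) pe) (sw_same Vt).
move=> eC; rewrite /sat_identity /= eval_sw_term.
have [pC|npC] := pselect (eval eC (lhs p) = eval eC (rhs p)); last first.
  exact: disc_sw_neq.
rewrite pC (sw_same Vt) //; have /choice[g gE] := hs.
have hg : h \o (g \o eC) = eC by apply: funext => n; rewrite /= gE.
have := quasi_identity_patch Vt (e := g \o eC) VA VC hh Aq pe0; rewrite hg.
by apply; apply/(sat_conj_premises Vt _ _ VC).
Qed.

(** An admissible quasi-identity defines a subquasivariety containing [F]; by minimality it is all
    of [V] or trivial, and in the latter case [F] and with it [V] are trivial. *)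
Lemma structurally_complete_of_minimal (F : algebra S) (x : nat -> F) :
  is_free_denumerable V x -> minimal_variety V -> structurally_complete V F.
Proof.
move=> Fx Vmin q Fq A VA.
have [[E VE] Vmin2] := minimal_variety_quasivariety Vmin.
have Wqvar : is_quasivariety (fun B => V B /\ holds_quasi_identity B q).
  exists (fun q' => E q' \/ q' = q) => B.
  split=> [[/VE VB Bq] q' [/VB|->]//|VB].
  by split; [apply/VE => q' Eq'; apply: VB; left|apply: VB; right].
apply: contrapT => nAq.
have /(Vmin2 _ Wqvar) trW :
    proper_subclass (fun B => V B /\ holds_quasi_identity B q) V.
  by split=> [B []//|/(_ A VA)[]].
have trF : trivial_algebra F by apply/trW; split=> //; exact: (proj1 Fx).
exact/nAq/trivial_holds_quasi/(free_trivial Fx trF).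
Qed.

Lemma structurally_complete_of_idempotent (F : algebra S) (x : nat -> F) :
  is_free_denumerable V x -> has_elementary_extension_with_idempotent F ->
  structurally_complete V F.
Proof.
move=> [VF univ] Fid q Fq A VA e pe.
have [a ca] := constant_solution (conj_premises t q) Fid.
have [h [hh hx _]] := univ A VA e.
have hxe : h \o x = e by apply: funext.
have := quasi_identity_patch Vt (e0 := fun _ => a) (e := x) VF VA hh Fq.
by rewrite hxe; apply=> //; apply/(sat_conj_premises Vt _ _ VF).
Qed.

Lemma minimal_of_structurally_complete (F : algebra S) (x : nat -> F) n
    (f : 'I_n -> op S) :
  is_variety V -> is_free_denumerable V x -> structurally_complete V F ->
  ~ (exists a : F, idempotent_for f a) -> minimal_variety V.
Proof.
move=> Vvar Fx Vsc noid; have [VF univ] := Fx.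
(* The premises say that variable 0 is a common idempotent, the conclusion forces triviality. As the
   premises always fail in [F], [q] is admissible. *)
pose q := QuasiIdentity
  (fun i => Identity (App (fun _ : 'I_(arity (f i)) => Var S 0)) (Var S 0))
  (Identity (Var S 1) (Var S 2)).
have qidem (A : algebra S) (e : nat -> A) :
    (forall i : 'I_(premise_count q), sat_identity e (premise i)) <->
    idempotent_for f (e 0) by [].
have ntF : ~ trivial_algebra F.
  move=> trF; apply: noid; case: (carrier_inhabited F) => a.
  by exists a => i; exact: trF.
have idem_trivial (A : algebra S) (a : A) :
    V A -> idempotent_for f a -> trivial_algebra A.
  have Fq : admissible F q by move=> e /qidem ide; case: noid; exists (e 0).
  by move=> VA ida b c; exact: (Vsc q Fq A VA (nth a [:: a; b; c]) ida).
split=> // W Wvar; split=> [[WV VW]|trW]; last first.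
  split=> [A /trW|/(_ F VF)/trW//]; exact: variety_trivial.
move=> C; split=> [WC|]; last exact: variety_trivial.
apply: contrapT => ntC.
have VC := WV C WC; have [E WE] := Wvar.
have [A [VA nWA]] : exists A, V A /\ ~ W A.
  apply: contrapT => nA; apply: VW => A VA.
  by apply: contrapT => nWA; apply: nA; exists A.
have [p [Ep nAp]] : exists p, E p /\ ~ holds_identity A p.
  apply: contrapT => np; apply: nWA; apply/WE => p Ep.
  by apply: contrapT => nAp; apply: np; exists p.
have /existsNP[e pe] := nAp.
have [||B [h [VB Bt hh hs hP]]] := discriminator_quotient
  (P := fun u v => u = eval e (lhs p) /\ v = eval e (rhs p)) Vvar Vt VA.
- by move=> c [-> ].
- by move=> c d u v u' v' [-> ->] [-> ->]; rewrite !(sw_const Vt).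
have Bp : ~ sat_identity (h \o e) p.
  by rewrite /sat_identity -!(hom_eval _ _ hh); exact: hP.
set u := conj_premises t q.
(* [r] demands a common idempotent at variable 0 only where [p] holds; so it is satisfied in [B] at
   [h \o e], where [p] fails. *)
pose r := Identity (sw_term t (lhs p) (rhs p) (lhs u) (rhs u)) (rhs u).
pose q' := QuasiIdentity (fun _ : 'I_1 => r) p.
(* [q'] fails in [B], hence in [F] by structural completeness; this gives a solution [e1] of [r] in
   [F]. *)
have /existsNP[e1 /not_implyP[re1 _]] : ~ holds_quasi_identity F q'.
  move=> /Vsc/(_ B VB)/(_ (h \o e)) Bq'; apply: (Bp); apply: Bq' => _ /=.
  by rewrite /sat_identity /= eval_sw_term; exact: (disc_sw_neq _ _ Bt Bp).
case: (carrier_inhabited C) => c0.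
(* [c0] is arbitrary: any homomorphism to [C] carries [e1] to a solution of [r], and as [p] holds in
   [C], its value at 0 is a common idempotent. *)
have [g [gh _ _]] := univ C VC (fun _ => c0).
have Cp : sat_identity (g \o e1) p by move/WE: WC => /(_ p Ep); exact.
have /(congr1 g) := re1 ord0; rewrite /= !(hom_eval _ _ gh) /= eval_sw_term.
rewrite Cp (sw_same Vt) // => ue.
apply: ntC; apply: (idem_trivial C (g (e1 0)) VC).
apply: (proj1 (qidem C (g \o e1))).
exact: (proj1 (sat_conj_premises Vt q (g \o e1) VC)).
Qed.
End Minimal.

Theorem theorem5p5 (S : signature) (V : algebra_class S)
    (F : algebra S) (x : nat -> F) :
  discriminator_variety V ->
  is_free_denumerable V x ->
  (structurally_complete V F <->
     has_elementary_extension_with_idempotent F \/ minimal_variety V) /\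
  (minimal_variety V <-> minimal_quasivariety V).
Proof.
move=> [K [[Vvar _ Vgen] [t Kt]]] Fx.
have Vt : discriminator_identities V t.
  move=> p discp A VA.
  (* Satisfaction of [p] defines a variety containing [K], hence containing [V]. *)
  have pvar : is_variety (fun B => holds_identity B p).
    by exists (eq p) => B; split=> [Bp _ <-//|]; exact.
  by apply: (Vgen _ pvar) VA => B KB; exact/discp/Kt.
split; last first.
  split; first exact: (minimal_variety_quasivariety Vt).
  exact: minimal_quasivariety_variety.
split=> [Vsc|[Fid|Vmin]].
- have [Vmin|nmin] := pselect (minimal_variety V); first by right.
  left; apply: extension_with_idempotent => n f; apply: contrapT => noid.
  exact/nmin/(minimal_of_structurally_complete Vt Vvar Fx Vsc noid).
- exact: (structurally_complete_of_idempotent Vt Fx).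
- exact: (structurally_complete_of_minimal Vt Fx).
Qed.
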